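(* Consider the decentralized control problem with partially observed mean-field sharing described in the context. Let $\Delta(\mathcal M_n)$ be the space of probability distributions on $\mathcal M_n$. Define $V_{T+1}(\pi):=0$ for all $\pi\in\Delta(\mathcal M_n)$ and, recursively for $t=T,\dots,1$ and $\pi_t\in\Delta(\mathcal M_n)$, $$V_t(\pi_t)=\min_{\gamma_t}\Big(\tilde\ell_t(\pi_t,\gamma_t)+\mathbb E[V_{t+1}(\Pi_{t+1})\mid \Pi_t=\pi_t,\Gamma_t=\gamma_t]\Big),$$ where the minimum is over all functions $\gamma_t:\mathcal X\to\mathcal U$. Let $\psi^*_t(\pi)$ be a minimizer of the right-hand side at time $t$ and $\pi_t=\pi$, and define $g^*_t(\pi,x):=\psi^*_t(\pi)(x)$ for $\pi\in\Delta(\mathcal M_n)$, $x\in\mathcal X$. Then $\mathbf g^*=(g_1^*,\dots,g^*_T)$, used as $U^i_t=g^*_t(\Pi_t,X^i_t)$ for all $i$ and $t$, is an optimal strategy: $J(\mathbf g^* )\le J(\mathbf g)$ for every control strategy $\mathbf g=(g_1,\dots,g_T)$ of the form $U^i_t=g_t(Y_{1:t},X^i_t)$, $i=1,\dots,n$ (identical control laws at all controllers).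
   Context: Model. $n,T\in\mathbb N$; $\mathcal X$ (states) and $\mathcal U$ (actions) are finite sets. Subsystem $i\in\{1,\dots,n\}$ has state $X^i_t\in\mathcal X$ and action $U^i_t\in\mathcal U$ at time $t$; $\mathbf X_t=(X^1_t,\dots,X^n_t)$, $\mathbf U_t=(U^1_t,\dots,U^n_t)$. The mean-field is $Z_t=\frac1n\sum_{i=1}^n\delta_{X^i_t}$, i.e. $Z_t(x)=\frac1n\sum_{i}\mathbb 1(X^i_t=x)$, taking values in the set $\mathcal M_n$ of probability distributions on $\mathcal X$ whose values all lie in $\{0,\frac1n,\dots,\frac nn\}$. Dynamics: $X^i_{t+1}=f_t(X^i_t,U^i_t,W^i_t,Z_t)$ for $t=1,\dots,T$, with given functions $f_t$ not depending on $i$. Observation: $Y_t=h_t(Z_t,N_t)\in\mathcal Y$ for $t=1,\dots,T$, with given functions $h_t$ and noises $N_t$ in a finite set $\mathcal N$ with PMF $P_{N_t}$. The initial states $X^i_1$ have common PMF $P_X$, the noises $W^i_t$ are discrete with PMF $P_{W_t}$ (not depending on $i$), and all of $X^1_1,\dots,X^n_1$, $W^i_t$, $N_t$ ($1\le i\le n$, $1\le t\le T$) are mutually independent. Costs: arbitrary functions $\ell_t:\mathcal X^n\times\mathcal U^n\to\mathbb R$. Decentralized problem. Controller $i$ observes $Y_{1:t}=(Y_1,\dots,Y_t)$ and $X^i_t$. Control laws are pure (deterministic) and identical at all controllers: $U^i_t=g_t(Y_{1:t},X^i_t)$ with $g_t:\mathcal Y^t\times\mathcal X\to\mathcal U$;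 $\mathbf g=(g_1,\dots,g_T)$ is the control strategy, with cost $J(\mathbf g)=\mathbb E^{\mathbf g}[\sum_{t=1}^T\ell_t(\mathbf X_t,\mathbf U_t)]$. Optimal means minimizing $J$ over all such $\mathbf g$. Let $\Gamma_t:\mathcal X\to\mathcal U$ be the map applied by all controllers at time $t$ ($U^i_t=\Gamma_t(X^i_t)$, with $\Gamma_t=g_t(Y_{1:t},\cdot)$) and $\Pi_t(z):=\mathbb P(Z_t=z\mid Y_{1:t},\Gamma_{1:t-1})$, $z\in\mathcal M_n$. Since $\Pi_t$ is computed from $Y_{1:t}$ and the past maps $\Gamma_{1:t-1}$, the rule $U^i_t=g^*_t(\Pi_t,X^i_t)$ (with $\Gamma_t=\psi^*_t(\Pi_t)$) is a control strategy of the form $U^i_t=g_t(Y_{1:t},X^i_t)$ with $g_t:\mathcal Y^t\times\mathcal X\to\mathcal U$ identical at all controllers. Notation in the dynamic program. For $\gamma:\mathcal X\to\mathcal U$ write $\ell_t(\mathbf x,\gamma):=\ell_t(\mathbf x,(\gamma(x^1),\dots,\gamma(x^n)))$. For $z\in\mathcal M_n$ let $H(z)=\{\mathbf x\in\mathcal X^n:\frac1n\sum_i\delta_{x^i}=z\}$ and $\hat\ell_t(z,\gamma)=\frac1{|H(z)|}\sum_{\mathbf x\in H(z)}\ell_t(\mathbf x,\gamma)$; then $\tilde\ell_t(\pi,\gamma):=\sum_{z\in\mathcal M_n}\hat\ell_t(z,\gamma)\pi(z)$. Let $p_t(\cdot\mid z,\gamma)$ be the law of $\frac1n\sum_i\delta_{f_t(x^i,\gamma(x^i),W^i_t,z)}$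 with $\mathbf x$ uniform on $H(z)$ and independent of $(W^1_t,\dots,W^n_t)$; put $p_t(z'\mid\pi,\gamma)=\sum_z p_t(z'\mid z,\gamma)\pi(z)$ and, for $t<T$, $r_{t+1}(y\mid z')=\mathbb P(h_{t+1}(z',N_{t+1})=y)$. Given $\Pi_t=\pi,\Gamma_t=\gamma$ (for any $\pi,\gamma$), $Y_{t+1}=y$ has probability $q_t(y\mid\pi,\gamma)=\sum_{z'}r_{t+1}(y\mid z')p_t(z'\mid\pi,\gamma)$, and on $Y_{t+1}=y$ with $q_t(y\mid\pi,\gamma)>0$ one has $\Pi_{t+1}(z')=r_{t+1}(y\mid z')p_t(z'\mid\pi,\gamma)/q_t(y\mid\pi,\gamma)$; this defines the conditional expectation in the recursion for $t<T$ (for $t=T$ it is $0$). *)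

(* Defs.v *)
From HB Require Import structures.
From mathcomp Require Import all_boot all_order all_algebra.
From mathcomp Require Import all_classical all_reals all_analysis.

Set Implicit Arguments.
Unset Strict Implicit.
Unset Printing Implicit Defensive.

Import Order.TTheory GRing.Theory Num.Theory.
Import numFieldNormedType.Exports.

Local Open Scope classical_set_scope.
Local Open Scope ring_scope.

(* The set M_n is encoded by counts: z stands for the distribution
   x |-> (z x) / n, see [mf_val] and [emp_valE] below. *)
Definition meanfield (n : nat) (X : finType) : finType :=
  {z : {ffun X -> 'I_n.+1} | (\sum_x (z x : nat) == n)%N}.

Definition mf_val (R : realType) (n : nat) (X : finType)
  (z : meanfield n X) (x : X) : R := (val z x)%:R / n%:R.

Definition counts (n : nat) (X : finType) (x : {ffun 'I_n -> X}) :
  {ffun X -> 'I_n.+1} := [ffun a => inord #|[set i | x i == a]%SET|].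

Lemma countsE (n : nat) (X : finType) (x : {ffun 'I_n -> X}) (a : X) :
  counts x a = #|[set i | x i == a]%SET| :> nat.
Proof. by rewrite ffunE inordK // ltnS -[leqRHS]card_ord max_card. Qed.

Lemma counts_sum (n : nat) (X : finType) (x : {ffun 'I_n -> X}) :
  (\sum_a (counts x a : nat) == n)%N.
Proof.
rewrite (eq_bigr (fun a => \sum_(i | x i == a) 1)%N); last first.
  by move=> a _; rewrite countsE -sum1_card; apply: eq_bigl => i; rewrite inE.
apply/eqP; rewrite -[RHS]card_ord -sum1_card.
by rewrite [RHS](partition_big (fun i => x i) predT).
Qed.

Definition emp (n : nat) (X : finType) (x : {ffun 'I_n -> X}) : meanfield n X :=
  Sub (counts x) (counts_sum x).

Lemma emp_valE (R : realType) (n : nat) (X : finType) (x : {ffun 'I_n -> X})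
  (a : X) : mf_val R (emp x) a = n%:R^-1 * \sum_(i < n) (x i == a)%:R.
Proof.
rewrite /mf_val SubK countsE mulrC; congr (_ * _).
rewrite -sum1_card natr_sum big_mkcond /=; apply: eq_bigr => i _.
by rewrite inE; case: eqP.
Qed.

(* The space Delta(A) of probability distributions on a finite set A. *)
Definition is_distr (R : realType) (A : finType) (p : {ffun A -> R}) : Prop :=
  (forall a, 0 <= p a) /\ \sum_a p a = 1.

(* Minimum over a finite type; the value 0 is only used when A is empty. *)
Definition fmin (R : realType) (A : finType) (F : A -> R) : R :=
  if [pick a : A] is Some a0 then \big[Order.min/F a0]_(a : A) F a else 0.

Section Probability.
Context {d : measure_display} {Om : measurableType d} {R : realType}.
Variable P : probability Om R.

Definition Pr (A : set Om) : R := fine (P A).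

(* Equal to 0 when Pr B = 0, since x / 0 = 0. *)
Definition condPr (A B : set Om) : R := Pr (A `&` B) / Pr B.

(* xi is a discrete random variable (values in a countable type) with PMF p. *)
Definition has_pmf (A : countType) (xi : Om -> A) (p : A -> R) : Prop :=
  forall a, measurable [set w | xi w = a] /\ Pr [set w | xi w = a] = p a.

(* Mutual independence of the variables X1 i, W i t, N t with i < n and
   1 <= t <= T: product rule for all events {X1 i \in A i}, {W i t \in B i t},
   {N t \in C t}.  Subfamilies are covered by taking full sets; all sets of
   values are allowed since the value types are countable. *)
Definition mutually_independent (n T : nat) (X W N : countType)
    (X1 : 'I_n -> Om -> X) (w : 'I_n -> nat -> Om -> W) (v : nat -> Om -> N) :=
  forall (A : 'I_n -> set X) (B : 'I_n -> nat -> set W) (C : nat -> set N),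
    Pr [set o | [/\ (forall i, A i (X1 i o)),
                    (forall i t, (1 <= t <= T)%N -> B i t (w i t o)) &
                    (forall t, (1 <= t <= T)%N -> C t (v t o))]] =
      (\prod_(i < n) Pr (X1 i @^-1` A i)) *
      (\prod_(i < n) \prod_(1 <= t < T.+1) Pr (w i t @^-1` B i t)) *
      (\prod_(1 <= t < T.+1) Pr (v t @^-1` C t)).

End Probability.

Section MeanFieldSharing.
Context {d : measure_display} {Om : measurableType d} {R : realType}.
Variable P : probability Om R.
Context {n : nat} {X U N : finType} {W : countType} {Y : eqType}.
Variables (f : nat -> X -> U -> W -> meanfield n X -> X)
          (h : nat -> meanfield n X -> N -> Y)
          (l : nat -> {ffun 'I_n -> X} -> {ffun 'I_n -> U} -> R)
          (X1 : 'I_n -> Om -> X)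
          (w : 'I_n -> nat -> Om -> W)
          (v : nat -> Om -> N).

(* Control laws g_t : Y^t * X -> U, the same at every controller. *)
Definition strategy := forall t : nat, t.-tuple Y -> X -> U.

Section ClosedLoop.
Variable g : strategy.

(* [traj t o] is the pair (X_{t+1}, Y_{1:t}); times start at 1. *)
Fixpoint traj (t : nat) (o : Om) : {ffun 'I_n -> X} * t.-tuple Y :=
  match t with
  | 0 => ([ffun i => X1 i o], [tuple])
  | s.+1 =>
      let: (x, ys) := traj s o in
      let z := emp x in
      let ys' := [tuple of rcons ys (h s.+1 z (v s.+1 o))] in
      ([ffun i => f s.+1 (x i) (g ys' (x i)) (w i s.+1 o) z], ys')
  end.

Definition state (t : nat) (o : Om) : {ffun 'I_n -> X} := (traj t.-1 o).1.

Definition history (t : nat) (o : Om) : t.-tuple Y := (traj t o).2.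

Definition mfield (t : nat) (o : Om) : meanfield n X := emp (state t o).

Definition prescription (t : nat) (o : Om) : {ffun X -> U} :=
  [ffun x => g (history t o) x].

Definition action (t : nat) (o : Om) : {ffun 'I_n -> U} :=
  [ffun i => g (history t o) (state t o i)].

(* Pi_t(z) = P(Z_t = z | Y_{1:t}, Gamma_{1:t-1}), as a random variable. *)
Definition belief (t : nat) (o : Om) : {ffun meanfield n X -> R} :=
  [ffun z => condPr P [set o' | mfield t o' = z]
     [set o' | history t o' = history t o /\
               forall s, (1 <= s < t)%N -> prescription s o' = prescription s o]].

Definition total_cost (T : nat) : \bar R :=
  'E_P[fun o => (\sum_(1 <= t < T.+1) l t (state t o) (action t o))%R]%E.

(* The strategy g is the rule U^i_t = gs_t(Pi_t, X^i_t), for t = 1, ..., T. *)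
Definition implements (T : nat)
    (gs : nat -> {ffun meanfield n X -> R} -> X -> U) : Prop :=
  forall (t : nat) (o : Om) (x : X), (1 <= t <= T)%N ->
    g (history t o) x = gs t (belief t o) x.

End ClosedLoop.

Definition optimal (T : nat) (g : strategy) : Prop :=
  forall g' : strategy, (total_cost g T <= total_cost g' T)%E.

Section DynamicProgram.
Implicit Types (p : {ffun meanfield n X -> R}) (c : {ffun X -> U})
  (z : meanfield n X).

Definition H z : {set {ffun 'I_n -> X}} := [set x | emp x == z]%SET.

Definition lhat (t : nat) z c : R :=
  #|H z|%:R^-1 * \sum_(x in H z) l t x [ffun i => c (x i)].

Definition ltilde (t : nat) p c : R := \sum_z lhat t z c * p z.

(* p_t(z' | z, gamma): x is uniform on H(z), independently of W_t. *)
Definition trans (t : nat) z c (z' : meanfield n X) : R :=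
  #|H z|%:R^-1 * \sum_(x in H z)
    Pr P [set o | emp [ffun i => f t (x i) (c (x i)) (w i t o) z] = z'].

Definition predict (t : nat) p c (z' : meanfield n X) : R :=
  \sum_z trans t z c z' * p z.

(* r_t(y | z) *)
Definition obs_prob (t : nat) (z : meanfield n X) (y : Y) : R :=
  Pr P [set o | h t z (v t o) = y].

(* q_t(y | pi, gamma) *)
Definition next_obs_prob (t : nat) p c (y : Y) : R :=
  \sum_z' obs_prob t.+1 z' y * predict t p c z'.

Definition update (t : nat) p c (y : Y) : {ffun meanfield n X -> R} :=
  [ffun z' => obs_prob t.+1 z' y * predict t p c z' / next_obs_prob t p c y].

(* The finitely many values that Y_t can take. *)
Definition obs_values (t : nat) : seq Y :=
  undup [seq h t zm.1 zm.2 | zm : meanfield n X * N].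

(* E[V(Pi_{t+1}) | Pi_t = p, Gamma_t = c] *)
Definition cond_exp_next (t : nat) p c (V : {ffun meanfield n X -> R} -> R) : R :=
  \sum_(y <- obs_values t.+1 | 0 < next_obs_prob t p c y)
    next_obs_prob t p c y * V (update t p c y).

(* [value_to_go k t]: value function at time t with k stages left. *)
Fixpoint value_to_go (k t : nat) p : R :=
  if k is k'.+1 then
    fmin (fun c => ltilde t p c + cond_exp_next t p c (value_to_go k' t.+1))
  else 0.

Variable T : nat.

Definition value (t : nat) p : R := value_to_go (T.+1 - t) t p.

(* The right-hand side of the recursion, before minimization.  At t = T the
   second term vanishes because [value T.+1] does. *)
Definition bellman (t : nat) p c : R :=
  ltilde t p c + cond_exp_next t p c (value t.+1).

Lemma value_last p : value T.+1 p = 0.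
Proof. by rewrite /value subnn. Qed.

Lemma value_rec (t : nat) p : (t <= T)%N -> value t p = fmin (bellman t p).
Proof. by move=> tT; rewrite /value subSn. Qed.

End DynamicProgram.

End MeanFieldSharing.

(* Main.v *)
Require Import Defs.
From HB Require Import structures.
From mathcomp Require Import all_boot all_order all_algebra fingroup perm.
From mathcomp Require Import all_classical all_reals all_analysis.

(** The noises enter the same way in all subsystems, so the joint law of the
    state vector and of the observations is invariant under permutations of
    the subsystems ([Pr_traj_permute]).  Two state vectors with the same
    mean-field are permutations of each other ([emp_eqP]); hence, given the
    observations and the mean-field [z], the state vector is uniform on [H z]
    ([joint_weight]).  This is why a cost depending on the whole state vector
    averages to [lhat], and why the mean-field evolves by the kernel [trans].

    Beliefs are handled through their unnormalized version
    [weight u z = P(Z_t = z, Y_{1:t} = u)]: it obeys a filter without division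
    ([weight_step]), the prescription in force being [g_t(u, .)], and it makes
    null histories harmless, their weight being the zero function.  The
    expected cost is the sum of [ltilde t (weight u) (g_t(u, .))] over times and
    histories ([total_costE]).

    Extend the value function to unnormalized beliefs by homogeneity
    ([weighted_value]).  Multiplied by the mass of the weight, the Bellman
    recursion then has no conditional expectation left: the weighted value at
    time [t] is at most the stage cost plus the sum over [y] of the weighted
    values at time [t + 1], with equality as soon as the prescription minimizes
    ([weighted_value_le], [weighted_value_eq]).  Summing over histories and
    telescoping over time, the expected value at time 1, which does not depend
    on the strategy, bounds every cost from below and is the cost of any
    strategy that applies a minimizer.

    The joint law itself is obtained by induction on time.  Because the states
    take finitely many values, the event that a given state and history are
    reached, intersected with a product event on the later noises, is a finite
    disjoint union of events of the same form one step earlier ([future_step]),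
    down to the product events of the independence hypothesis; this gives the
    Markov property without conditioning on sigma-algebras ([traj_future]).

    A strategy following the rule exists because the belief at time [t] only
    involves the control laws before [t] ([belief_at_ext]). *)

Set Implicit Arguments.
Unset Strict Implicit.
Unset Printing Implicit Defensive.

Import Order.TTheory GRing.Theory Num.Theory.
Import numFieldNormedType.Exports.

Local Open Scope classical_set_scope.
Local Open Scope ring_scope.

(** * Probabilities and expectations of finite-valued quantities *)

Section Events.
Context {d : measure_display} {Om : measurableType d} {R : realType}.
Variable P : probability Om R.

Lemma Pr_ge0 (A : set Om) : 0 <= Pr P A.
Proof. by rewrite /Pr fine_ge0. Qed.

Lemma PrT : Pr P setT = 1.
Proof. by rewrite /Pr probability_setT. Qed.

Lemma EFin_Pr (A : set Om) : measurable A -> (Pr P A)%:E = P A.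
Proof. by move=> mA; rewrite /Pr fineK// fin_num_measure. Qed.

Lemma measurable_all (I : countType) (A : I -> set Om) :
  (forall i, measurable (A i)) -> measurable [set o | forall i, A i o].
Proof.
move=> mA; rewrite (_ : [set o | _] = ~` (\bigcup_i (~` A i))).
  apply/measurableC/countable_bigcupT_measurable; first exact: countableP.
  by move=> i; exact: measurableC.
by rewrite setC_bigcup; apply/seteqP; split=> o /= + i; [move=> + _|];
  move=> /(_ i); rewrite setCK //; apply.
Qed.

Lemma measurable_imply (Q : Prop) (A : set Om) :
  (Q -> measurable A) -> measurable [set o | Q -> A o].
Proof.
move=> mA; have [q|nq] := pselect Q.
  rewrite (_ : [set o | _] = A); first exact: mA.
  by apply/seteqP; split=> o /=; auto.
by rewrite (_ : [set o | _] = setT)//; apply/seteqP; split=> o /=.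
Qed.

Lemma measurable_prop (Q : Prop) : measurable ([set _ | Q] : set Om).
Proof.
have [q|nq] := pselect Q.
  by rewrite (_ : [set _ | Q] = setT)//; apply/seteqP; split.
by rewrite (_ : [set _ | Q] = set0)//; apply/seteqP; split.
Qed.

Lemma measurable_ex (I : countType) (A : I -> set Om) :
  (forall i, measurable (A i)) -> measurable [set o | exists i, A i o].
Proof.
move=> mA; rewrite (_ : [set o | _] = \bigcup_i A i).
  by apply: countable_bigcupT_measurable; first exact: countableP.
by apply/seteqP; split=> o [i]; [exists i|move=> _; exists i].
Qed.

(** Integrability is carried along with the value, so that finite sums of simple
    functions can be integrated term by term. *)
Definition has_mean (F : Om -> R) (e : R) :=
  F \in Lfun P 1 /\ 'E_P[F]%E = e%:E.

Lemma has_mean_uniq F e e' : has_mean F e -> has_mean F e' -> e = e'.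
Proof. by move=> [_ E] [_]; rewrite E => -[]. Qed.

Lemma has_mean_indic (k : R) (A : set Om) : measurable A ->
  has_mean (fun o => k * \1_A o) (k * Pr P A).
Proof.
move=> mA; have mem : (\1_A : Om -> R) \in Lfun P 1.
  by apply/Lfun1_integrable; exact: integrable_indic.
rewrite (_ : (fun o => _) = k \o* \1_A); last first.
  by apply/funext => o; rewrite /= mulrC.
split; first exact: Lfun_scale.
by rewrite expectationZl// expectation_indic// EFinM EFin_Pr.
Qed.

Lemma has_mean_sum (I : eqType) (s : seq I) (F : I -> Om -> R) (e : I -> R) :
  (forall i, i \in s -> has_mean (F i) (e i)) ->
  has_mean (fun o => \sum_(i <- s) F i o) (\sum_(i <- s) e i).
Proof.
elim: s => [|i s IH] hF.
  rewrite big_nil (_ : (fun o => _) = cst 0).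
    by split; [exact: Lfun_cst|rewrite expectation_cst].
  by apply/funext => o; rewrite big_nil.
have [mi Ei] := hF i (mem_head _ _).
have [ms Es] := IH (fun j js => hF j (mem_behead (s := i :: s) js)).
rewrite (_ : (fun o => _) = F i \+ (fun o => \sum_(j <- s) F j o)).
  split; first exact: (rpredD mi).
  by rewrite expectationD// Ei Es big_cons.
by apply/funext => o; rewrite big_cons.
Qed.

(** The indicator of [E] is the sum of those of the pieces. *)
Lemma Pr_partition (I : finType) (k : Om -> I) (E : set Om) :
  (forall i, measurable (E `&` [set o | k o = i])) ->
  measurable E ->
  Pr P E = \sum_i Pr P (E `&` [set o | k o = i]).
Proof.
move=> mE mE'.
have H1 : has_mean (fun o => 1 * \1_E o) (1 * Pr P E) by exact: has_mean_indic.
have H2 := has_mean_sum (s := index_enum I)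
  (fun i _ => has_mean_indic 1 (mE i)).
rewrite -[LHS]mul1r (has_mean_uniq H1
  (e' := \sum_i 1 * Pr P (E `&` [set o | k o = i]))).
  by apply: eq_bigr => i _; rewrite mul1r.
congr has_mean: H2; apply/funext => o.
rewrite (bigD1 (k o))//= big1 ?addr0; last first.
  move=> i ik; rewrite mul1r indicE memNset// => -[_ /= ko].
  by rewrite ko eqxx in ik.
rewrite !mul1r !indicE; congr ((_ : bool)%:R).
by apply/idP/idP; rewrite !inE //= => -[].
Qed.

End Events.

(** * Laws of variables with values in a countable type *)

Section CountableLaw.
Context {d : measure_display} {Om : measurableType d} {R : realType}.
Variable P : probability Om R.
Variables (A : countType) (p : A -> R) (B : set A).

(* Values are enumerated through their codes, so that preimages are countable
   unions of the slices below, each of which is empty or the event that the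
   variable takes one given value. *)
Let slice (xi : Om -> A) k := [set o | pickle (xi o) = k /\ B (xi o)].

Let sliceE (xi : Om -> A) k :
  slice xi k = if @pickle_inv A k is Some a then
    if `[< B a >] then [set o | xi o = a] else set0 else set0.
Proof.
rewrite /slice; have := pickle_invK (T := A) k.
case E: (pickle_inv k) => [a|] /= K.
  case: asboolP => Ba.
    apply/seteqP; split=> o /= => [[xk _]|->//].
    by apply: (pcan_inj (@pickleK_inv A)); rewrite xk.
  apply/seteqP; split=> o //= -[xk Bx]; apply: Ba.
  by rewrite (_ : a = xi o)//; apply: (pcan_inj (@pickleK_inv A)); rewrite xk.
by apply/seteqP; split=> o //= -[xk _]; move: E; rewrite -xk pickleK_inv.
Qed.

Let preimageE (xi : Om -> A) : xi @^-1` B = \bigcup_k slice xi k.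
Proof.
apply/seteqP; split=> o /=; first by exists (pickle (xi o)).
by case=> k _ [].
Qed.

Let measurable_slice (xi : Om -> A) k : has_pmf P xi p ->
  measurable (slice xi k).
Proof.
move=> hxi; rewrite sliceE; case: pickle_inv => [a|//].
by case: asboolP => // _; case: (hxi a).
Qed.

Lemma has_pmf_measurable (xi : Om -> A) : has_pmf P xi p ->
  measurable (xi @^-1` B).
Proof.
move=> hxi; rewrite preimageE; apply: bigcupT_measurable => k.
exact: measurable_slice.
Qed.

(** Equality of the probability mass functions only concerns single values;
    countable additivity over the slices extends it to all sets of values. *)
Lemma has_pmf_same_law (xi xi' : Om -> A) : has_pmf P xi p ->
  has_pmf P xi' p -> Pr P (xi @^-1` B) = Pr P (xi' @^-1` B).
Proof.
move=> hxi hxi'; rewrite !preimageE /Pr.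
rewrite !measure_bigcup.
- congr fine; apply: eq_eseriesr => k _.
  have m := measurable_slice k hxi; have m' := measurable_slice k hxi'.
  rewrite -[LHS](EFin_Pr P m) -[RHS](EFin_Pr P m'); congr EFin.
  rewrite !sliceE.
  case: pickle_inv => [a|//]; case: asboolP => // _.
  by case: (hxi a) => _ ->; case: (hxi' a) => _ ->.
- by move=> k _; exact: measurable_slice.
- by move=> i j _ _ [x [[ <- _] [ <- _]]].
- by move=> k _; exact: measurable_slice.
- by move=> i j _ _ [x [[ <- _] [ <- _]]].
Qed.

End CountableLaw.

(** * Mean-fields as orbits of state vectors under permutations *)

Section Permutations.
Context {n : nat} {X : finType}.
Implicit Type x : {ffun 'I_n -> X}.

Definition permute (s : 'S_n) (x : {ffun 'I_n -> X}) : {ffun 'I_n -> X} :=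
  [ffun i => x (s i)].

Lemma permuteK s : cancel (permute s) (permute s^-1%g).
Proof. by move=> x; apply/ffunP => i; rewrite !ffunE permKV. Qed.

Lemma emp_permute s x : emp (permute s x) = emp x.
Proof.
apply/val_inj/ffunP => a; apply/val_inj; rewrite /= !countsE.
rewrite -[RHS](card_imset _ (@perm_inj _ s^-1%g)); apply: eq_card => i.
rewrite !inE ffunE; apply/eqP/imsetP => [xa|[j + ->]].
  by exists (s i); rewrite ?inE ?xa ?permK.
by rewrite inE permKV => /eqP.
Qed.

(** Equal counts make the two vectors equal as multisets. *)
Lemma emp_eqP x x' : emp x = emp x' -> exists s, x' = permute s x.
Proof.
move=> e; have : perm_eq [tuple x' i | i < n] [tuple x i | i < n].
  apply/allP => a _; rewrite /= !count_map.
  move: e => /(congr1 val)/ffunP/(_ a)/(congr1 val) /=; rewrite !countsE.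
  rewrite -!sum1_card -!sum1_count -!enumT !big_enum_cond /= => e.
  apply/eqP; rewrite (eq_bigl (fun i => i \in [set i | x' i == a]%SET)).
    by rewrite -e; apply: eq_bigl => i; rewrite !inE.
  by move=> i; rewrite !inE.
move=> /tuple_permP[s /val_inj e']; exists s.
apply/ffunP => i; have := congr1 (fun u => tnth u i) e'.
by rewrite !tnth_mktuple ffunE.
Qed.

End Permutations.

(** * Observation histories *)

Lemma rcons_tupleP (Y : eqType) (t : nat) (u : t.+1.-tuple Y) :
  exists (ys : t.-tuple Y) (y : Y), u = [tuple of rcons ys y].
Proof.
case: u => s; case/lastP: s => [//|s y] ss.
have ss' : size s == t by move: ss; rewrite size_rcons.
by exists (Tuple ss'), y; exact: val_inj.
Qed.

Lemma rcons_tuple_inj (Y : eqType) (t : nat) (ys ys' : t.-tuple Y) (y y' : Y) :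
  [tuple of rcons ys y] = [tuple of rcons ys' y'] -> ys = ys' /\ y = y'.
Proof.
by move=> /(congr1 val)/rcons_inj[/val_inj -> ->].
Qed.

Section Histories.
Context {n : nat} {X N : finType} {Y : eqType}.
Variable h : nat -> meanfield n X -> N -> Y.

(** The finitely many sequences that [h] can produce, so that sums over
    histories make sense for an arbitrary observation type. *)
Fixpoint histories (t : nat) : seq (t.-tuple Y) :=
  match t with
  | 0 => [:: [tuple]]
  | s.+1 => [seq [tuple of rcons ys y] | ys : s.-tuple Y <- histories s,
                                         y : Y <- obs_values h s.+1]
  end.

Lemma big_histories (R : realType) t (F : t.+1.-tuple Y -> R) :
  \sum_(u <- histories t.+1) F u =
  \sum_(ys <- histories t) \sum_(y <- obs_values h t.+1)
    F [tuple of rcons ys y].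
Proof. exact: big_allpairs_dep. Qed.

Lemma histories_uniq t : uniq (histories t).
Proof.
elim: t => [//|t IH] /=; apply: allpairs_uniq => //; first exact: undup_uniq.
by move=> [a b] [a' b'] _ _ /= /rcons_tuple_inj[-> ->].
Qed.

End Histories.

(** * The Bellman recursion for unnormalized beliefs *)

Section Minimum.
Context {R : realType} {A : finType}.
Implicit Type F : A -> R.

Lemma fmin_le F a : fmin F <= F a.
Proof. by rewrite /fmin; case: pickP => [a0 _|/(_ a)//]; exact: bigmin_le. Qed.

Lemma fmin_eq F a : (forall b, F a <= F b) ->
  fmin F = F a.
Proof.
move=> aF; apply: le_anti; rewrite fmin_le /= /fmin.
by case: pickP => [a0 _|/(_ a)//]; apply/bigmin_geP; split.
Qed.

End Minimum.

Section DynamicProgramming.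
Context {d : measure_display} {Om : measurableType d} {R : realType}.
Variable P : probability Om R.
Context {n : nat} {X U N : finType} {W : countType} {Y : eqType}.
Variables (f : nat -> X -> U -> W -> meanfield n X -> X)
          (h : nat -> meanfield n X -> N -> Y)
          (l : nat -> {ffun 'I_n -> X} -> {ffun 'I_n -> U} -> R)
          (w : 'I_n -> nat -> Om -> W)
          (v : nat -> Om -> N)
          (T : nat).
Implicit Types (p : {ffun meanfield n X -> R}) (c : {ffun X -> U})
  (z : meanfield n X).

Local Notation obs_prob := (obs_prob P h v).
Local Notation predict := (predict P f w).
Local Notation trans := (trans P f w).
Local Notation value := (value P f h l w v T).
Local Notation bellman := (bellman P f h l w v T).
Local Notation next_obs_prob := (next_obs_prob P f h w v).
Local Notation update := (update P f h w v).

Definition normalize p : {ffun meanfield n X -> R} :=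
  [ffun z => p z / \sum_z' p z'].

(** The numerator of Bayes' rule: joint mass of the next mean-field and the next
    observation [y]. *)
Definition posterior (t : nat) p c (y : Y) : {ffun meanfield n X -> R} :=
  [ffun z => obs_prob t.+1 z y * predict t p c z].

(** The extension of the value function that is homogeneous of degree one; it is
    0 at the zero function, whatever [value] is there. *)
Definition weighted_value (t : nat) p : R :=
  (\sum_z p z) * value t (normalize p).

Lemma normalize_distr p : (forall z, 0 <= p z) -> 0 < \sum_z p z ->
  is_distr (normalize p).
Proof.
move=> p0 m0; split=> [z|].
  by rewrite ffunE divr_ge0// ltW.
under eq_bigr => z _ do rewrite ffunE.
by rewrite -big_distrl /= divff// gt_eqF.
Qed.

Lemma trans_ge0 t z c z' : 0 <= trans t z c z'.
Proof.
by rewrite /trans mulr_ge0// ?invr_ge0// sumr_ge0// => x _; exact: Pr_ge0.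
Qed.

Lemma predict_ge0 t p c z : (forall z, 0 <= p z) -> 0 <= predict t p c z.
Proof.
by move=> p0; apply: sumr_ge0 => z' _; rewrite mulr_ge0// trans_ge0.
Qed.

Lemma posterior_ge0 t p c y z : (forall z, 0 <= p z) ->
  0 <= posterior t p c y z.
Proof. by move=> p0; rewrite ffunE mulr_ge0 ?predict_ge0// Pr_ge0. Qed.

Lemma posterior_mass t p c y :
  \sum_z posterior t p c y z = next_obs_prob t p c y.
Proof. by apply: eq_bigr => z _; rewrite ffunE. Qed.

Lemma predict_normalize t p c z :
  predict t (normalize p) c z = predict t p c z / \sum_z p z.
Proof.
by rewrite /predict big_distrl /=; apply: eq_bigr => z' _; rewrite ffunE mulrA.
Qed.

Lemma next_obs_prob_normalize t p c y :
  next_obs_prob t (normalize p) c y = next_obs_prob t p c y / \sum_z p z.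
Proof.
rewrite /next_obs_prob big_distrl /=; apply: eq_bigr => z' _.
by rewrite predict_normalize mulrA.
Qed.

Lemma ltilde_normalize t p c :
  ltilde l t (normalize p) c = ltilde l t p c / \sum_z p z.
Proof.
by rewrite /ltilde big_distrl /=; apply: eq_bigr => z' _; rewrite ffunE mulrA.
Qed.

Lemma update_normalize t p c y : \sum_z p z != 0 ->
  update t (normalize p) c y = normalize (posterior t p c y).
Proof.
move=> m0; apply/ffunP => z; rewrite !ffunE posterior_mass.
by rewrite predict_normalize next_obs_prob_normalize invf_div -!mulrA mulKf.
Qed.

(** The probability of [y] cancels the denominator of Bayes' rule, so that the
    conditional expectation becomes a plain sum; observations of probability 0,
    skipped on the left, have a zero posterior on the right. *)
Lemma bellman_normalize t p c : (forall z, 0 <= p z) -> \sum_z p z != 0 ->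
  (\sum_z p z) * bellman t (normalize p) c =
  ltilde l t p c +
    \sum_(y <- obs_values h t.+1) weighted_value t.+1 (posterior t p c y).
Proof.
move=> p0 m0; have m_gt0 : 0 < \sum_z p z by rewrite lt0r m0 sumr_ge0.
rewrite /bellman mulrDr ltilde_normalize mulrCA divff// mulr1; congr (_ + _).
rewrite /cond_exp_next [X in _ * X]big_mkcond big_distrr /=.
apply: eq_bigr => y _.
rewrite /weighted_value posterior_mass next_obs_prob_normalize.
rewrite pmulr_lgt0 ?invr_gt0//; case: ifPn => [q_gt0|].
  by rewrite update_normalize// mulrA mulrCA divff// mulr1.
rewrite -leNgt => q_le0; have -> : next_obs_prob t p c y = 0.
  apply: le_anti; rewrite q_le0 -posterior_mass sumr_ge0// => z _.
  exact: posterior_ge0.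
by rewrite mul0r mulr0.
Qed.

(** All terms are integrals against [p], which vanishes. *)
Lemma weighted_value_mass0 t p c : (forall z, 0 <= p z) -> \sum_z p z = 0 ->
  weighted_value t p = ltilde l t p c +
    \sum_(y <- obs_values h t.+1) weighted_value t.+1 (posterior t p c y).
Proof.
move=> p0 m0; have pz z : p z = 0.
  by apply/eqP; move/eqP: m0; rewrite psumr_eq0// => /allP/(_ z); apply;
    rewrite mem_index_enum.
rewrite /weighted_value m0 mul0r /ltilde !big1 ?addr0// => [y _|z _].
  rewrite big1 ?mul0r// => z _; rewrite ffunE /predict big1 ?mulr0// => z' _.
  by rewrite pz mulr0.
by rewrite pz mulr0.
Qed.

Lemma weighted_value_le t p c : (forall z, 0 <= p z) -> (t <= T)%N ->
  weighted_value t p <= ltilde l t p c +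
    \sum_(y <- obs_values h t.+1) weighted_value t.+1 (posterior t p c y).
Proof.
move=> p0 tT; have [m0|m0] := eqVneq (\sum_z p z) 0.
  by rewrite -weighted_value_mass0.
rewrite -bellman_normalize// /weighted_value value_rec//.
by rewrite ler_wpM2l ?fmin_le// sumr_ge0.
Qed.

Lemma weighted_value_eq t p c : (forall z, 0 <= p z) -> (t <= T)%N ->
  (0 < \sum_z p z ->
   forall c', bellman t (normalize p) c <= bellman t (normalize p) c') ->
  weighted_value t p = ltilde l t p c +
    \sum_(y <- obs_values h t.+1) weighted_value t.+1 (posterior t p c y).
Proof.
move=> p0 tT cmin; have [m0|m0] := eqVneq (\sum_z p z) 0.
  exact: weighted_value_mass0.
rewrite -bellman_normalize// /weighted_value value_rec//; congr (_ * _).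
by apply/fmin_eq/cmin; rewrite lt0r m0 sumr_ge0.
Qed.

Lemma weighted_value_last p : weighted_value T.+1 p = 0.
Proof. by rewrite /weighted_value value_last mulr0. Qed.

End DynamicProgramming.

(** * The joint law of states and observations *)

Section JointLaw.
Context {d : measure_display} {Om : measurableType d} {R : realType}.
Variable P : probability Om R.
Context {n T : nat} {X U N : finType} {W : countType} {Y : eqType}.
Variables (f : nat -> X -> U -> W -> meanfield n X -> X)
          (h : nat -> meanfield n X -> N -> Y)
          (X1 : 'I_n -> Om -> X)
          (w : 'I_n -> nat -> Om -> W)
          (v : nat -> Om -> N)
          (PX : X -> R) (PW : nat -> W -> R) (PN : nat -> N -> R).
Hypothesis X1_pmf : forall i : 'I_n, has_pmf P (X1 i) PX.
Hypothesis w_pmf : forall (i : 'I_n) (t : nat), (1 <= t <= T)%N ->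
  has_pmf P (w i t) (PW t).
Hypothesis v_pmf : forall t : nat, (1 <= t <= T)%N -> has_pmf P (v t) (PN t).
Hypothesis indep : mutually_independent P T X1 w v.
Variable g : @strategy X U Y.

Local Notation traj := (traj f h X1 w v g).
Local Notation obs_prob := (obs_prob P h v).

Definition future (t : nat) (B : 'I_n -> nat -> set W) (C : nat -> set N) :
    set Om :=
  [set o | (forall i s, (t < s <= T)%N -> B i s (w i s o)) /\
           (forall s, (t < s <= T)%N -> C s (v s o))].

Definition future_mass (t : nat) (B : 'I_n -> nat -> set W)
    (C : nat -> set N) : R :=
  (\prod_(i < n) \prod_(t.+1 <= s < T.+1) Pr P (w i s @^-1` B i s)) *
  \prod_(t.+1 <= s < T.+1) Pr P (v s @^-1` C s).

(** The transition probability of the state vector under the prescription [c],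
    a product because the noises of the subsystems are independent. *)
Definition kernel (t : nat) (c : X -> U) (x x' : {ffun 'I_n -> X}) : R :=
  \prod_(i < n)
    Pr P (w i t @^-1` [set b | f t (x i) (c (x i)) b (emp x) = x' i]).

Lemma future_massT t : future_mass t (fun _ _ => setT) (fun _ => setT) = 1.
Proof.
rewrite /future_mass !big1 ?mulr1// => s _.
- by rewrite preimage_setT PrT.
- by rewrite big1// => i _; rewrite preimage_setT PrT.
Qed.

Lemma futureT t : future t (fun _ _ => setT) (fun _ => setT) = setT.
Proof. by apply/seteqP; split=> o. Qed.

Lemma trajS t o x x' (ys : t.-tuple Y) y :
  (traj t.+1 o = (x', [tuple of rcons ys y]) /\ (traj t o).1 = x) <->
  [/\ traj t o = (x, ys), h t.+1 (emp x) (v t.+1 o) = y &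
      forall i, f t.+1 (x i) (g [tuple of rcons ys y] (x i)) (w i t.+1 o)
        (emp x) = x' i].
Proof.
rewrite /=; case: (traj t o) => a b /=; split.
  move=> [[+ +] ax]; rewrite ax => <- /esym/rcons_inj[/val_inj <- <-].
  by split=> // i; rewrite ffunE.
move=> [[-> ->] <- e]; split=> //; congr pair.
by apply/ffunP => i; rewrite ffunE e.
Qed.

Lemma measurable_future t B C : measurable (future t B C).
Proof.
have mB : measurable [set o | forall i s, (t < s <= T)%N -> B i s (w i s o)].
  apply: measurable_all => i; apply: measurable_all => s.
  apply: (@measurable_imply _ _ _ (w i s @^-1` B i s)) => /andP[ts sT].
  apply: (has_pmf_measurable (p := PW s)); apply: w_pmf.
  by rewrite (leq_ltn_trans _ ts).
have mC : measurable [set o | forall s, (t < s <= T)%N -> C s (v s o)].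
  apply: measurable_all => s.
  apply: (@measurable_imply _ _ _ (v s @^-1` C s)) => /andP[ts sT].
  apply: (has_pmf_measurable (p := PN s)); apply: v_pmf.
  by rewrite (leq_ltn_trans _ ts).
exact: measurableI mB mC.
Qed.

Lemma measurable_traj t x (ys : t.-tuple Y) : (t <= T)%N ->
  measurable [set o | traj t o = (x, ys)].
Proof.
elim: t x ys => [|t IH] x ys tT.
  rewrite (_ : [set o | _] = [set o | forall i, X1 i o = x i]).
    by apply: measurable_all => i; case: (X1_pmf i (x i)).
  apply/seteqP; split=> o /=.
    by move=> [<- _] i; rewrite ffunE.
  move=> e; rewrite (tuple0 ys); congr pair.
  by apply/ffunP => i; rewrite ffunE.
have [{}ys [y ->]] := rcons_tupleP ys.
rewrite (_ : [set o | _] = [set o | exists x0 : {ffun 'I_n -> X},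
  [set o | traj t o = (x0, ys)] o /\
  ([set o | h t.+1 (emp x0) (v t.+1 o) = y] o /\
  (forall i, [set o | f t.+1 (x0 i) (g [tuple of rcons ys y] (x0 i))
     (w i t.+1 o) (emp x0) = x i] o))]).
  apply: measurable_ex => x0; apply: measurableI; first exact/IH/ltnW.
  apply: measurableI.
    exact: (has_pmf_measurable [set m | h t.+1 (emp x0) m = y]
      (v_pmf (t := t.+1) tT)).
  apply: measurable_all => i.
  exact: (has_pmf_measurable [set b | f t.+1 (x0 i) _ b (emp x0) = x i]
      (w_pmf i (t := t.+1) tT)).
apply/seteqP; split=> o.
  move=> e; exists (traj t o).1.
  by have /trajS[] : traj t.+1 o = (x, [tuple of rcons ys y]) /\
    (traj t o).1 = (traj t o).1 by [].
by move=> [x0 [a [b c]]]; have /trajS[] := And3 a b c.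
Qed.

Lemma measurable_traj_future t x (ys : t.-tuple Y) B C : (t <= T)%N ->
  measurable [set o | traj t o = (x, ys) /\ future t B C o].
Proof.
move=> tT.
exact: measurableI (measurable_traj _ _ tT) (measurable_future _ _ _).
Qed.

(** Once the state [x] at the previous time is known, reaching [x'] after
    observing [y] is a product event on the noises of time [t + 1] only. *)
Lemma future_step t x (ys : t.-tuple Y) y x' B C : (t < T)%N ->
  exists B' C',
   (future_mass t B' C' = obs_prob t.+1 (emp x) y *
      kernel t.+1 (g [tuple of rcons ys y]) x x' * future_mass t.+1 B C) /\
   [set o | (traj t.+1 o = (x', [tuple of rcons ys y]) /\
             future t.+1 B C o)] `&`
     [set o | (traj t o).1 = x] =
   [set o | traj t o = (x, ys) /\ future t B' C' o].
Proof.
move=> tT.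
(* The constraints at time [t + 1] are added to those on the later noises. *)
pose B' i s := if s == t.+1
  then [set b | f s (x i) (g [tuple of rcons ys y] (x i)) b (emp x) = x' i]
  else B i s.
pose C' s := if s == t.+1 then [set m | h s (emp x) m = y] else C s.
exists B', C'; split.
  rewrite /future_mass.
  have -> : \prod_(i < n) \prod_(t.+1 <= s < T.+1) Pr P (w i s @^-1` B' i s) =
      kernel t.+1 (g [tuple of rcons ys y]) x x' *
      \prod_(i < n) \prod_(t.+2 <= s < T.+1) Pr P (w i s @^-1` B i s).
    rewrite -big_split /=; apply: eq_bigr => i _.
    rewrite big_ltn// {1}/B' eqxx; congr (_ * _).
    by apply: eq_big_nat => s /andP[ts _]; rewrite /B' gtn_eqF.
  have -> : \prod_(t.+1 <= s < T.+1) Pr P (v s @^-1` C' s) =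
      obs_prob t.+1 (emp x) y *
      \prod_(t.+2 <= s < T.+1) Pr P (v s @^-1` C s).
    rewrite big_ltn// {1}/C' eqxx; congr (_ * _).
    by apply: eq_big_nat => s /andP[ts _]; rewrite /C' gtn_eqF.
  by rewrite mulrACA mulrA [kernel _ _ _ _ * _]mulrC !mulrA.
apply/seteqP; split=> o.
  move=> [[e [eB eC]] e1]; have /trajS[e2 ey ex] := conj e e1.
  split=> //; split=> [i s|s]; rewrite leq_eqVlt => /andP[/orP[/eqP<-|ts] sT].
  - by rewrite /B' eqxx; exact: ex.
  - by rewrite /B' gtn_eqF//; apply: eB; rewrite ts.
  - by rewrite /C' eqxx.
  - by rewrite /C' gtn_eqF//; apply: eC; rewrite ts.
move=> [e [eB eC]].
have /trajS[e1 e2] : [/\ traj t o = (x, ys), h t.+1 (emp x) (v t.+1 o) = y &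
      forall i, f t.+1 (x i) (g [tuple of rcons ys y] (x i)) (w i t.+1 o)
        (emp x) = x' i].
  split=> //.
    by have := eC t.+1; rewrite /C' eqxx; apply; rewrite leqnn.
  by move=> i; have := eB i t.+1; rewrite /B' eqxx; apply; rewrite leqnn.
split=> //; split=> //; split=> [i s|s] /andP[ts sT].
  by have := eB i s; rewrite /B' gtn_eqF//; apply; rewrite (ltnW ts).
by have := eC s; rewrite /C' gtn_eqF//; apply; rewrite (ltnW ts).
Qed.

(** Summing over the previous state turns the Markov property at time [t] into
    the one-step recursion and, [B] and [C] being free, into the Markov property
    at time [t + 1]. *)
Lemma traj_future_step t x' (ys : t.-tuple Y) y B C : (t < T)%N ->
  (forall x B C, Pr P [set o | traj t o = (x, ys) /\ future t B C o] =
    Pr P [set o | traj t o = (x, ys)] * future_mass t B C) ->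
  Pr P [set o | traj t.+1 o = (x', [tuple of rcons ys y]) /\
                future t.+1 B C o] =
  (\sum_x Pr P [set o | traj t o = (x, ys)] * (obs_prob t.+1 (emp x) y *
      kernel t.+1 (g [tuple of rcons ys y]) x x')) * future_mass t.+1 B C.
Proof.
move=> tT IH.
rewrite (@Pr_partition _ _ _ P _ (fun o => (traj t o).1)); last 2 first.
- move=> x; have [B' [C' [_ ->]]] := future_step x ys y x' B C tT.
  by apply: measurable_traj_future; exact: ltnW.
- exact: measurable_traj_future.
rewrite big_distrl /=; apply: eq_bigr => x _.
have [B' [C' [eM ->]]] := future_step x ys y x' B C tT.
by rewrite IH eM !mulrA.
Qed.

(** The source of the Markov property.  The induction needs arbitrary events on
    all the later noises, because each step uses up those of the next time. *)
Lemma traj_future t x (ys : t.-tuple Y) B C : (t <= T)%N ->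
  Pr P [set o | traj t o = (x, ys) /\ future t B C o] =
  Pr P [set o | traj t o = (x, ys)] * future_mass t B C.
Proof.
elim: t x ys B C => [|t IH] x ys B C tT.
  have E B' C' : Pr P [set o | traj 0 o = (x, ys) /\ future 0 B' C' o] =
      \prod_(i < n) Pr P (X1 i @^-1` [set x i]) * future_mass 0 B' C'.
    rewrite /future_mass mulrA -(indep (fun i => [set x i]) B' C').
    congr Pr; apply/seteqP; split=> o /=.
      by move=> [[<- _] [eB eC]]; split=> // i; rewrite ffunE.
    move=> [e eB eC]; split; last by split.
    rewrite (tuple0 ys); congr pair.
    by apply/ffunP => i; rewrite ffunE e.
  rewrite E; congr (_ * _); have := E (fun _ _ => setT) (fun _ => setT).
  rewrite future_massT futureT mulr1 => <-.
  by congr Pr; apply/seteqP; split=> o //= -[].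
have [{}ys [y ->]] := rcons_tupleP ys.
have IH' x' B' C' := IH x' ys B' C' (ltnW tT).
rewrite (traj_future_step _ _ _ _ tT IH'); congr (_ * _).
have := traj_future_step x y (fun _ _ => setT) (fun _ => setT) tT IH'.
rewrite future_massT futureT mulr1 => <-.
by congr Pr; apply/seteqP; split=> o //= -[].
Qed.

Local Notation state := (state f h X1 w v g).
Local Notation history := (history f h X1 w v g).
Local Notation mfield := (mfield f h X1 w v g).
Local Notation predict := (predict P f w).

Lemma Pr_traj0 x (ys : 0.-tuple Y) :
  Pr P [set o | traj 0 o = (x, ys)] = \prod_(i < n) PX (x i).
Proof.
rewrite (eq_bigr (fun i => Pr P (X1 i @^-1` [set x i]))); last first.
  by move=> i _; case: (X1_pmf i (x i)) => _ <-.
have := indep (fun i => [set x i]) (fun _ _ => setT) (fun _ => setT).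
have M : future_mass 0 (fun _ _ => setT) (fun _ => setT) = 1 := future_massT 0.
rewrite -mulrA -/(future_mass 0 (fun _ _ => setT) (fun _ => setT)).
rewrite M mulr1 => <-.
congr Pr; apply/seteqP; split=> o /=.
  by move=> [<- _]; split=> // i; rewrite ffunE.
move=> [e _ _]; rewrite (tuple0 ys); congr pair.
by apply/ffunP => i; rewrite ffunE e.
Qed.

Definition joint (t : nat) (x : {ffun 'I_n -> X}) (u : t.-tuple Y) : R :=
  Pr P [set o | state t o = x /\ history t o = u].

Lemma state_historyE t x (ys : t.-tuple Y) y :
  [set o | state t.+1 o = x /\ history t.+1 o = [tuple of rcons ys y]] =
  [set o | traj t o = (x, ys)] `&` [set o | h t.+1 (emp x) (v t.+1 o) = y].
Proof.
apply/seteqP; split=> o; rewrite /state /history /=; case: (traj t o) => a b /=.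
  by move=> [->] /rcons_tuple_inj[-> ->].
by move=> [[-> ->] <-].
Qed.

(** The noise of the observation at time [t + 1] is independent of the
    trajectory up to time [t]. *)
Lemma jointE t x (ys : t.-tuple Y) y : (t < T)%N ->
  joint x [tuple of rcons ys y] =
  Pr P [set o | traj t o = (x, ys)] * obs_prob t.+1 (emp x) y.
Proof.
move=> tT; rewrite /joint state_historyE.
pose C s := if s == t.+1 then [set m | h s (emp x) m = y] else setT.
have -> : [set o | traj t o = (x, ys)] `&`
    [set o | h t.+1 (emp x) (v t.+1 o) = y] =
  [set o | traj t o = (x, ys) /\ future t (fun _ _ => setT) C o].
  apply/seteqP; split=> o [eo].
    by move=> /= ho; split=> //; split=> // s _; rewrite /C; case: eqP => [->|].
  move=> [_ /(_ t.+1)]; rewrite /C eqxx => hC; split=> //.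
  by apply: hC; rewrite leqnn.
rewrite (traj_future _ _ _ _ (ltnW tT)); congr (_ * _).
rewrite /future_mass big1 ?mul1r; last first.
  by move=> i _; rewrite big1// => s _; rewrite preimage_setT PrT.
rewrite big_ltn// big_nat_cond big1 ?mulr1; first by rewrite /C eqxx.
by move=> s /andP[/andP[ts _] _]; rewrite /C gtn_eqF// preimage_setT PrT.
Qed.

Lemma Pr_trajS t x' (u : t.+1.-tuple Y) : (t < T)%N ->
  Pr P [set o | traj t.+1 o = (x', u)] =
  \sum_x joint x u * kernel t.+1 (g u) x x'.
Proof.
move=> tT; have [ys [y ->]] := rcons_tupleP u.
have IH x B C := @traj_future t x ys B C (ltnW tT).
have := traj_future_step x' y (fun _ _ => setT) (fun _ => setT) tT IH.
rewrite future_massT futureT mulr1.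
rewrite (_ : [set o | (_ /\ setT o)] =
  [set o | traj t.+1 o = (x', [tuple of rcons ys y])]); last first.
  by apply/seteqP; split=> o // -[].
by move=> ->; apply: eq_bigr => x _; rewrite jointE// mulrA.
Qed.

(** The dynamics and the law of the noise are the same in all subsystems, and
    the mean-field is unchanged by the permutation. *)
Lemma kernel_permute t c s x x' : (1 <= t <= T)%N ->
  kernel t c (permute s x) (permute s x') = kernel t c x x'.
Proof.
move=> tT; rewrite /kernel [RHS](reindex_inj (@perm_inj _ s)) /=.
apply: eq_bigr => i _; rewrite !ffunE emp_permute.
exact: has_pmf_same_law (w_pmf _ tT) (w_pmf _ tT).
Qed.

(** Exchangeability of the subsystems is preserved over time because they all
    apply the same prescription. *)
Lemma Pr_traj_permute t s x (ys : t.-tuple Y) : (t <= T)%N ->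
  Pr P [set o | traj t o = (permute s x, ys)] =
  Pr P [set o | traj t o = (x, ys)].
Proof.
elim: t x ys => [|t IH] x ys tT.
  rewrite !Pr_traj0 [RHS](reindex_inj (@perm_inj _ s)) /=.
  by apply: eq_bigr => i _; rewrite ffunE.
rewrite !Pr_trajS// (reindex_inj (can_inj (permuteK s))) /=.
apply: eq_bigr => x0 _; rewrite kernel_permute//; congr (_ * _).
have [{}ys [y ->]] := rcons_tupleP ys.
by rewrite !jointE// IH ?emp_permute// ltnW.
Qed.

Lemma joint_emp t x x' (u : t.+1.-tuple Y) : (t < T)%N -> emp x = emp x' ->
  joint x u = joint x' u.
Proof.
move=> tT e; have [s ->] := emp_eqP e; have [ys [y ->]] := rcons_tupleP u.
by rewrite !jointE// emp_permute Pr_traj_permute// ltnW.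
Qed.

Lemma measurable_joint t x (u : t.+1.-tuple Y) : (t < T)%N ->
  measurable [set o | state t.+1 o = x /\ history t.+1 o = u].
Proof.
move=> tT; have [ys [y ->]] := rcons_tupleP u; rewrite state_historyE.
apply: measurableI; first by apply: measurable_traj; exact: ltnW.
exact: (has_pmf_measurable [set m | h t.+1 (emp x) m = y]
      (v_pmf (t := t.+1) tT)).
Qed.

(** The unnormalized belief. *)
Definition weight (t : nat) (u : t.-tuple Y) : {ffun meanfield n X -> R} :=
  [ffun z => Pr P [set o | mfield t o = z /\ history t o = u]].

Lemma measurable_weight t z (u : t.+1.-tuple Y) : (t < T)%N ->
  measurable [set o | mfield t.+1 o = z /\ history t.+1 o = u].
Proof.
move=> tT; rewrite (_ : [set o | _] = [set o | exists x,
    [set _ | emp x = z] o /\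
    [set o | state t.+1 o = x /\ history t.+1 o = u] o]).
  apply: measurable_ex => x; apply: measurableI; first exact: measurable_prop.
  exact: measurable_joint.
apply/seteqP; split=> o /=; rewrite /mfield.
  by move=> [e e']; exists (state t.+1 o).
by move=> [x [e [ex e']]]; rewrite ex.
Qed.

Lemma weightE t (u : t.+1.-tuple Y) z : (t < T)%N ->
  weight u z = \sum_(x in H z) joint x u.
Proof.
move=> tT; rewrite ffunE (@Pr_partition _ _ _ P _ (state t.+1)).
- rewrite [RHS]big_mkcond /=; apply: eq_bigr => x _; rewrite inE.
  case: eqP => [xz|xz].
    congr Pr; apply/seteqP; split=> o /=; rewrite /mfield.
      by move=> [[_ ->] ->].
    by move=> [-> ->].
  rewrite (_ : _ `&` _ = set0) ?/Pr ?measure0//.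
  by apply/seteqP; split=> o //= -[[]]; rewrite /mfield => + _ e; rewrite e.
- move=> x; rewrite (_ : _ `&` _ = [set _ | emp x = z] `&`
    [set o | state t.+1 o = x /\ history t.+1 o = u]).
    by apply: measurableI; [exact: measurable_prop|exact: measurable_joint].
  apply/seteqP; split=> o /=; rewrite /mfield.
    by move=> [[+ ->] e]; rewrite e.
  by move=> [+ [e ->]]; rewrite e.
- exact: measurable_weight.
Qed.

(** Given history and mean-field, the state vector is uniform on [H z], by
    exchangeability. *)
Lemma joint_weight t x (u : t.+1.-tuple Y) : (t < T)%N ->
  joint x u = #|H (emp x)|%:R^-1 * weight u (emp x).
Proof.
move=> tT; rewrite weightE//.
rewrite (eq_bigr (fun=> joint x u)); last first.
  by move=> x'; rewrite inE => /eqP; exact: joint_emp.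
rewrite sumr_const -[X in _ * X]mulr_natl mulKf// pnatr_eq0 -lt0n.
by apply/card_gt0P; exists x; rewrite inE.
Qed.

Lemma weight_ge0 t (u : t.-tuple Y) z : 0 <= weight u z.
Proof. by rewrite ffunE Pr_ge0. Qed.

Lemma measurable_history t (u : t.+1.-tuple Y) : (t < T)%N ->
  measurable [set o | history t.+1 o = u].
Proof.
move=> tT; rewrite (_ : [set o | _] = [set o | exists x,
    [set o | state t.+1 o = x /\ history t.+1 o = u] o]).
  by apply: measurable_ex => x; exact: measurable_joint.
apply/seteqP; split=> o /=; first by move=> e; exists (state t.+1 o).
by move=> [x []].
Qed.

Lemma weight_mass t (u : t.+1.-tuple Y) : (t < T)%N ->
  \sum_z weight u z = Pr P [set o | history t.+1 o = u].
Proof.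
move=> tT; rewrite (@Pr_partition _ _ _ P _ (mfield t.+1)).
- apply: eq_bigr => z _; rewrite ffunE; congr Pr.
  by rewrite setIC.
- by move=> z; rewrite setIC; exact: measurable_weight.
- exact: measurable_history.
Qed.

(** The product rule for the noises of one time step, the other variables
    being left unconstrained. *)
Lemma Pr_noise t (B : 'I_n -> set W) : (1 <= t <= T)%N ->
  Pr P [set o | forall i, B i (w i t o)] = \prod_i Pr P (w i t @^-1` B i).
Proof.
move=> tT.
pose B' i s := if s == t then B i else setT.
have -> : [set o | forall i, B i (w i t o)] =
  [set o | [/\ (forall i, setT (X1 i o)),
    (forall i s, (1 <= s <= T)%N -> B' i s (w i s o)) &
    (forall s, (1 <= s <= T)%N -> setT (v s o))]].
  apply/seteqP; split=> o /=.
    by move=> hB; split=> // i s _; rewrite /B'; case: eqP => [->|].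
  by move=> [_ + _] i => /(_ i t tT); rewrite /B' eqxx.
rewrite (indep (fun=> setT) B' (fun=> setT)).
rewrite big1 ?mul1r; last by move=> i _; rewrite preimage_setT PrT.
rewrite [X in _ * X]big1 ?mulr1; last by move=> s _; rewrite preimage_setT PrT.
apply: eq_bigr => i _; rewrite (bigD1_seq t)/= ?iota_uniq//; last first.
  by rewrite mem_index_iota ltnS.
rewrite {1}/B' eqxx big1 ?mulr1// => s st.
by rewrite /B' (negPf st) preimage_setT PrT.
Qed.

Lemma Pr_next_mfield t (c : X -> U) (x : {ffun 'I_n -> X}) z' :
  (1 <= t <= T)%N ->
  Pr P [set o | emp [ffun i => f t (x i) (c (x i)) (w i t o) (emp x)] = z'] =
  \sum_(x' in H z') kernel t c x x'.
Proof.
move=> tT.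
pose k o := [ffun i => f t (x i) (c (x i)) (w i t o) (emp x)].
have kE x' : [set o | k o = x'] = [set o | forall i,
    [set b | f t (x i) (c (x i)) b (emp x) = x' i] (w i t o)].
  apply/seteqP; split=> o /=; first by move=> <- i; rewrite ffunE.
  by move=> e; apply/ffunP => i; rewrite ffunE.
have mk x' : measurable [set o | k o = x'].
  rewrite kE; apply: measurable_all => i.
  exact: (has_pmf_measurable [set b | f t (x i) (c (x i)) b (emp x) = x' i]
    (w_pmf i tT)).
rewrite (@Pr_partition _ _ _ P _ k).
- rewrite [RHS]big_mkcond /=; apply: eq_bigr => x' _; rewrite inE.
  case: eqP => xz.
    rewrite /kernel -Pr_noise// -kE; congr Pr; apply/seteqP.
    by split=> o /=; [case|move=> e; rewrite -/(k o) e].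
  rewrite (_ : _ `&` _ = set0) ?/Pr ?measure0//.
  by apply/seteqP; split=> o //= -[+ e]; rewrite -/(k o) e.
- move=> x'.
  rewrite (_ : _ `&` _ = [set _ | emp x' = z'] `&` [set o | k o = x']).
    by apply: measurableI => //; exact: measurable_prop.
  by apply/seteqP; split=> o /= -[+ e]; rewrite -/(k o) e.
- rewrite (_ : [set o | _] = [set o | exists x',
    [set _ | emp x' = z'] o /\ [set o | k o = x'] o]).
    apply: measurable_ex => x'; apply: measurableI => //.
    exact: measurable_prop.
  apply/seteqP; split=> o /=; first by move=> e; exists (k o).
    by move=> [x' [<- <-]].
Qed.

(** The unnormalized filter.  The conditional uniformity of the state vector
    lets the sum over state vectors factor through their mean-fields. *)
Lemma weight_step t (u : t.+1.-tuple Y) y : (t.+1 < T)%N ->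
  weight [tuple of rcons u y] =
  [ffun z' => obs_prob t.+2 z' y *
              predict t.+1 (weight u) [ffun x => g u x] z'].
Proof.
move=> tT; apply/ffunP => z'; rewrite weightE// ffunE.
have tT' : (t < T)%N by exact: ltnW.
rewrite (eq_bigr (fun x' => obs_prob t.+2 z' y *
    \sum_x joint x u * kernel t.+1 (g u) x x')); last first.
  by move=> x'; rewrite inE => /eqP <-; rewrite jointE// mulrC Pr_trajS.
rewrite -big_distrr /=; congr (_ * _); rewrite exchange_big /= /predict.
rewrite (partition_big (@emp n X) predT) //=; apply: eq_bigr => z _.
rewrite /trans mulrAC big_distrr /=.
apply: eq_big => [x|x /eqP xz]; first by rewrite inE.
rewrite -big_distrr /= joint_weight// xz; congr (_ * _).
rewrite -xz -Pr_next_mfield//; congr Pr; apply/seteqP; split=> o /= <-.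
  by congr emp; apply/ffunP => i; rewrite !ffunE.
by congr emp; apply/ffunP => i; rewrite !ffunE.
Qed.

Lemma history_prefix s t o o' : (s <= t)%N -> history t o = history t o' ->
  history s o = history s o'.
Proof.
move=> /subnK <-; elim: (t - s)%N => [//|k IH] e; apply: IH.
have histS r x : history r.+1 x = [tuple of rcons (history r x)
    (h r.+1 (emp (traj r x).1) (v r.+1 x))].
  by rewrite /history /=; case: (traj r x).
move: e; rewrite addSn.
by rewrite !histS => /rcons_tuple_inj[].
Qed.

(** The past prescriptions are functions of the observations, so conditioning on
    them as well changes nothing. *)
Lemma belief_condPr t o z : belief P f h X1 w v g t o z =
  condPr P [set o' | mfield t o' = z] [set o' | history t o' = history t o].
Proof.
rewrite ffunE; congr condPr; apply/seteqP; split=> o' /=; first by case.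
move=> e; split=> // s /andP[_ st]; apply/ffunP => x.
by rewrite !ffunE (history_prefix (ltnW st) e).
Qed.

Lemma belief_weight t o : (t < T)%N ->
  belief P f h X1 w v g t.+1 o = normalize (weight (history t.+1 o)).
Proof.
move=> tT; apply/ffunP => z; rewrite belief_condPr !ffunE weight_mass//.
Qed.

Lemma history_in t o : history t o \in histories h t.
Proof.
elim: t => [|t IH] /=; first by rewrite (tuple0 (history 0 o)) mem_head.
move: IH; rewrite /history /=; case: (traj t o) => x ys /= hys.
apply: allpairs_f => //; rewrite mem_undup.
apply/mapP; exists (emp x, v t.+1 o) => //.
by rewrite mem_enum.
Qed.

(** The uniform average [lhat] is exact because the state vector is uniform
    given history and mean-field. *)
Lemma ltilde_weight (l : nat -> {ffun 'I_n -> X} -> {ffun 'I_n -> U} -> R)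
    t (u : t.+1.-tuple Y) (c : {ffun X -> U}) : (t < T)%N ->
  ltilde l t.+1 (weight u) c =
  \sum_x l t.+1 x [ffun i => c (x i)] * joint x u.
Proof.
move=> tT; rewrite /ltilde [RHS](partition_big (@emp n X) predT) //=.
apply: eq_bigr => z _; rewrite /lhat mulrAC big_distrr /=.
apply: eq_big => [x|x]; first by rewrite inE.
by rewrite inE => /eqP xz; rewrite joint_weight// xz mulrC.
Qed.

Lemma stage_cost (l : nat -> {ffun 'I_n -> X} -> {ffun 'I_n -> U} -> R) t :
  (t < T)%N ->
  has_mean P (fun o => l t.+1 (state t.+1 o) (action f h X1 w v g t.+1 o))
    (\sum_(u <- histories h t.+1) ltilde l t.+1 (weight u) [ffun x => g u x]).
Proof.
move=> tT.
pose A u x := [set o | state t.+1 o = x /\ history t.+1 o = u].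
pose k (u : t.+1.-tuple Y) (x : {ffun 'I_n -> X}) :=
  l t.+1 x [ffun i => [ffun a => g u a] (x i)].
rewrite (_ : (fun o => _) = fun o =>
    \sum_(u <- histories h t.+1) \sum_x k u x * \1_(A u x) o); last first.
  apply/funext => o.
  rewrite (bigD1_seq (history t.+1 o)) ?history_in ?histories_uniq//=.
  rewrite [X in _ = _ + X]big1 ?addr0; last first.
    move=> u hu; rewrite big1// => x _; rewrite indicE memNset ?mulr0//.
    by move=> [_ e]; rewrite e eqxx in hu.
  rewrite (bigD1 (state t.+1 o))//= big1 ?addr0; last first.
    move=> x hx; rewrite indicE memNset ?mulr0//.
    by move=> [e _]; rewrite e eqxx in hx.
  rewrite indicE mem_set// mulr1 /k; congr l.
  by apply/ffunP => i; rewrite !ffunE.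
apply: has_mean_sum => u _; rewrite ltilde_weight//.
apply: has_mean_sum => x _.
by apply: has_mean_indic; exact: measurable_joint.
Qed.

End JointLaw.

(** * Expected costs and expected values *)

Section Optimality.
Context {d : measure_display} {Om : measurableType d} {R : realType}.
Variable P : probability Om R.
Context {n T : nat} {X U N : finType} {W : countType} {Y : eqType}.
Variables (f : nat -> X -> U -> W -> meanfield n X -> X)
          (h : nat -> meanfield n X -> N -> Y)
          (l : nat -> {ffun 'I_n -> X} -> {ffun 'I_n -> U} -> R)
          (X1 : 'I_n -> Om -> X)
          (w : 'I_n -> nat -> Om -> W)
          (v : nat -> Om -> N)
          (PX : X -> R) (PW : nat -> W -> R) (PN : nat -> N -> R).
Hypothesis X1_pmf : forall i : 'I_n, has_pmf P (X1 i) PX.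
Hypothesis w_pmf : forall (i : 'I_n) (t : nat), (1 <= t <= T)%N ->
  has_pmf P (w i t) (PW t).
Hypothesis v_pmf : forall t : nat, (1 <= t <= T)%N -> has_pmf P (v t) (PN t).
Hypothesis indep : mutually_independent P T X1 w v.
Implicit Type g : @strategy X U Y.

Local Notation weight := (weight P f h X1 w v).
Local Notation history := (history f h X1 w v).
Local Notation weighted_value := (weighted_value P f h l w v T).
Local Notation bellman := (bellman P f h l w v T).

Definition expected_stage_cost g (t : nat) : R :=
  \sum_(u <- histories h t) ltilde l t (weight g u) [ffun x => g t u x].

Definition expected_value g (t : nat) : R :=
  \sum_(u <- histories h t) weighted_value t (weight g u).

Lemma total_costE g :
  total_cost P f h l X1 w v g T =
  (\sum_(1 <= t < T.+1) expected_stage_cost g t)%:E.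
Proof.
have [_ <-] : has_mean P (fun o => \sum_(1 <= t < T.+1)
    l t (state f h X1 w v g t o) (action f h X1 w v g t o))
    (\sum_(1 <= t < T.+1) expected_stage_cost g t); last by [].
apply: has_mean_sum => -[|t]; rewrite mem_index_iota //= ltnS => tT.
exact: (stage_cost f h X1_pmf w_pmf v_pmf indep).
Qed.

(** For [t + 1 < T] the posteriors are the weights of the next histories.  At
    the last stage they need not be, since no observation follows, but the
    values vanish on both sides. *)
Lemma sum_weighted_value_next g t : (t < T)%N ->
  \sum_(u <- histories h t.+1) \sum_(y <- obs_values h t.+2)
    weighted_value t.+2
      (posterior P f h w v t.+1 (weight g u) [ffun x => g t.+1 u x] y) =
  expected_value g t.+2.
Proof.
rewrite leq_eqVlt => /orP[/eqP tT|tT]; rewrite /expected_value.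
  rewrite tT [RHS]big1; last by move=> u _; rewrite weighted_value_last.
  by rewrite big1// => u _; rewrite big1// => y _; rewrite weighted_value_last.
rewrite [RHS]big_histories; apply: eq_bigr => u _.
apply: eq_bigr => y _; congr weighted_value.
by rewrite (weight_step f h X1_pmf w_pmf v_pmf indep).
Qed.

Lemma expected_value_le g t : (t < T)%N ->
  expected_value g t.+1 <= expected_stage_cost g t.+1 + expected_value g t.+2.
Proof.
move=> tT; rewrite -sum_weighted_value_next// -big_split /=.
apply: ler_sum => u _.
exact: weighted_value_le (weight_ge0 P f h X1 w v g u) tT.
Qed.

Lemma expected_value_eq g t : (t < T)%N ->
  (forall u : t.+1.-tuple Y, 0 < \sum_z weight g u z -> forall c,
     bellman t.+1 (normalize (weight g u)) [ffun x => g t.+1 u x] <=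
     bellman t.+1 (normalize (weight g u)) c) ->
  expected_value g t.+1 = expected_stage_cost g t.+1 + expected_value g t.+2.
Proof.
move=> tT gmin; rewrite -sum_weighted_value_next// -big_split /=.
apply: eq_bigr => u _.
exact: weighted_value_eq (weight_ge0 P f h X1 w v g u) tT (gmin u).
Qed.

Lemma expected_value_last g : expected_value g T.+1 = 0.
Proof.
by rewrite /expected_value big1// => u _; rewrite weighted_value_last.
Qed.

Lemma expected_value_telescope g :
  \sum_(1 <= t < T.+1) (expected_value g t - expected_value g t.+1) =
  expected_value g 1.
Proof.
rewrite (eq_bigr (fun t =>
    - (expected_value g t.+1 - expected_value g t))).
  by rewrite sumrN telescope_sumr// expected_value_last sub0r opprK.
by move=> t _; rewrite opprB.
Qed.

(** No control is applied before the first observation, so the first states and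
    histories of two strategies coincide by computation. *)
Lemma expected_value_init g g' : expected_value g 1 = expected_value g' 1.
Proof. by []. Qed.

Lemma total_cost_ge g :
  ((expected_value g 1)%:E <= total_cost P f h l X1 w v g T)%E.
Proof.
rewrite total_costE lee_fin -expected_value_telescope !big_add1 /=.
by apply: ler_sum_nat => t /= tT; rewrite lerBlDr expected_value_le.
Qed.

(** The rule constrains [g] only along histories that occur; the others have
    weight 0 and are exempted by [weighted_value_eq]. *)
Lemma total_cost_eq
    (psi : nat -> {ffun meanfield n X -> R} -> {ffun X -> U}) g :
  (forall (t : nat) (p : {ffun meanfield n X -> R}),
     (1 <= t <= T)%N -> is_distr p ->
     forall c : {ffun X -> U}, bellman t p (psi t p) <= bellman t p c) ->
  implements P f h X1 w v g T psi ->
  total_cost P f h l X1 w v g T = (expected_value g 1)%:E.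
Proof.
move=> psi_min gpsi; rewrite total_costE -expected_value_telescope !big_add1 /=.
congr EFin; apply: eq_big_nat => t /= tT.
apply/eqP; rewrite eq_sym subr_eq; apply/eqP.
apply: expected_value_eq => // u m_gt0.
have [om hu] : exists o, history g t.+1 o = u.
  apply: contrapT => no; move: m_gt0.
  rewrite (weight_mass f h X1_pmf w_pmf v_pmf)// (_ : [set o | _] = set0).
    by rewrite /Pr measure0 ltxx.
  by apply/seteqP; split=> o //= hu; apply: no; exists o.
have -> : [ffun x => g t.+1 u x] = psi t.+1 (normalize (weight g u)).
  apply/ffunP => x; rewrite ffunE -hu gpsi//.
  by rewrite (belief_weight f h X1_pmf w_pmf v_pmf).
apply: psi_min => //.
exact: normalize_distr (weight_ge0 P f h X1 w v g u) m_gt0.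
Qed.

End Optimality.

(** * Existence of a strategy that follows the rule *)

Section Existence.
Context {d : measure_display} {Om : measurableType d} {R : realType}.
Variable P : probability Om R.
Context {n : nat} {X U N : finType} {W : countType} {Y : eqType}.
Variables (f : nat -> X -> U -> W -> meanfield n X -> X)
          (h : nat -> meanfield n X -> N -> Y)
          (X1 : 'I_n -> Om -> X)
          (w : 'I_n -> nat -> Om -> W)
          (v : nat -> Om -> N)
          (psi : nat -> {ffun meanfield n X -> R} -> {ffun X -> U}).
Implicit Type g : @strategy X U Y.

(** The belief as a function of the history instead of the outcome. *)
Definition belief_at g (t : nat) (u : t.-tuple Y) : {ffun meanfield n X -> R} :=
  [ffun z => condPr P [set o | mfield f h X1 w v g t o = z]
                      [set o | history f h X1 w v g t o = u]].

Lemma traj_ext g g' t : (forall s, (s <= t)%N -> g s = g' s) ->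
  traj f h X1 w v g t = traj f h X1 w v g' t.
Proof.
elim: t => [//|t IH] gg; apply/funext => o /=.
by rewrite IH ?gg// => s st; exact/gg/leqW.
Qed.

Lemma belief_at_ext g g' t : (forall s, (s < t)%N -> g s = g' s) ->
  @belief_at g t = @belief_at g' t.
Proof.
case: t => [//|t] gg; have e := traj_ext gg.
have eh o : history f h X1 w v g t.+1 o = history f h X1 w v g' t.+1 o.
  by rewrite /history /= e; case: (traj _ _ _ _ _ _ _ _).
apply/funext => u; apply/ffunP => z; rewrite !ffunE.
congr condPr; apply/seteqP; split=> o /=; rewrite ?eh// /mfield /state /=.
  by rewrite e.
by rewrite e.
Qed.

(** Iterating the map that sends a strategy to the rule applied with the beliefs
    it generates: after [k] steps the laws at times before [k] no longer
    change. *)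
Fixpoint iterate (k : nat) : @strategy X U Y :=
  fun t u x => psi t (if k is k'.+1 then belief_at (@iterate k') u else 0) x.

Definition fixed_strategy : @strategy X U Y := fun t => @iterate t.+1 t.

Lemma iterate_fixed k t : (t < k)%N -> @iterate k t = @fixed_strategy t.
Proof.
elim/ltn_ind: k t => -[//|k] IH t; rewrite ltnS => tk /=.
apply/funext => u; apply/funext => x; rewrite /fixed_strategy /=.
rewrite (@belief_at_ext _ (@iterate t))// => s st.
by rewrite (IH k) ?(leq_trans st)// (IH t).
Qed.

Lemma fixed_strategyE t (u : t.-tuple Y) x :
  fixed_strategy u x = psi t (belief_at (@fixed_strategy) u) x.
Proof.
rewrite {1}/fixed_strategy /= (@belief_at_ext _ (@fixed_strategy))// => s st.
exact: iterate_fixed.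
Qed.

Lemma fixed_strategy_implements T :
  implements P f h X1 w v (@fixed_strategy) T psi.
Proof.
move=> t o x _; rewrite fixed_strategyE; congr (psi t _ x); apply/ffunP => z.
by rewrite belief_condPr ffunE.
Qed.

End Existence.

Theorem corollary2 (R : realType) (d : measure_display) (Om : measurableType d)
    (P : probability Om R) (n T : nat) (n_gt0 : (0 < n)%N)
    (X U N : finType) (W : countType) (Y : eqType)
    (f : nat -> X -> U -> W -> meanfield n X -> X)
    (h : nat -> meanfield n X -> N -> Y)
    (l : nat -> {ffun 'I_n -> X} -> {ffun 'I_n -> U} -> R)
    (X1 : 'I_n -> Om -> X) (w : 'I_n -> nat -> Om -> W) (v : nat -> Om -> N)
    (PX : X -> R) (PW : nat -> W -> R) (PN : nat -> N -> R)
    (X1_pmf : forall i : 'I_n, has_pmf P (X1 i) PX)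
    (w_pmf : forall (i : 'I_n) (t : nat), (1 <= t <= T)%N ->
       has_pmf P (w i t) (PW t))
    (v_pmf : forall t : nat, (1 <= t <= T)%N -> has_pmf P (v t) (PN t))
    (indep : mutually_independent P T X1 w v)
    (psi : nat -> {ffun meanfield n X -> R} -> {ffun X -> U})
    (psi_min : forall (t : nat) (p : {ffun meanfield n X -> R}),
       (1 <= t <= T)%N -> is_distr p ->
       forall c : {ffun X -> U},
         bellman P f h l w v T t p (psi t p) <= bellman P f h l w v T t p c) :
  let gstar := fun (t : nat) (p : {ffun meanfield n X -> R}) (x : X) =>
    psi t p x in
  (exists g : strategy, implements P f h X1 w v g T gstar) /\
  (forall g : strategy, implements P f h X1 w v g T gstar ->
     optimal P f h l X1 w v T g).
Proof.
move=> gstar; split.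
  exists (@fixed_strategy _ _ _ P _ _ _ _ _ _ f h X1 w v psi).
  exact: fixed_strategy_implements.
move=> g gpsi g'.
rewrite (total_cost_eq X1_pmf w_pmf v_pmf indep psi_min gpsi).
rewrite (expected_value_init P f h l X1 w v g g').
exact: (total_cost_ge f h l X1_pmf w_pmf v_pmf indep).
Qed.
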